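(* Let $k_1,l_1,\dots,k_r,l_r$ be positive integers, and let $k=\sum_{i=1}^r k_i$, $l=\sum_{i=1}^r l_i$. Let $q_n$ be the number of lattice paths from $(0,0)$ to $(ln,kn)$ that never go above the path $(N^{k_1}E^{l_1}\cdots N^{k_r}E^{l_r})^n$, and let $w_1,\dots,w_l$ be the unique solutions of the equation $$(w-1)^l - z\,w^{k+l}=0$$ (in the unknown $w$) that are fractional power series in $z$. Then the generating function $Q(z)=\sum_{n\ge0} q_n z^n$ is given by $$Q(z)=\frac{1}{z}\,R(w_1,\dots,w_l),$$ where $R$ is a computable symmetric rational function of $w_1,\dots,w_l$.
   Context: A lattice path is a finite sequence of steps, each being $N=(0,1)$ or $E=(1,0)$, starting at $(0,0)$. It is written as a word in the letters $N,E$; $N^a$ (resp. $E^a$) means $a$ consecutive $N$ (resp. $E$) steps, and $(W)^n$ is the word $W$ repeated $n$ times. The path $(N^{k_1}E^{l_1}\cdots N^{k_r}E^{l_r})^n$ goes from $(0,0)$ to $(ln,kn)$; for $n=0$ it is the empty path, and $q_0=1$. If $\pi$ and $P$ are lattice paths from $(0,0)$ to the same endpoint, $\pi$ never goes above $P$ if no point of $\pi$ lies strictly above $P$ (touching or sharing steps is allowed). Let $\mathbb{C}^{\mathrm{fra}}((z))$ be the field of fractional Laurent (Puiseux) series over $\mathbb{C}$, i.e. series of the form $\sum_{n\ge n_0} a_n z^{n/M}$ with $a_n\in\mathbb{C}$, $n_0\in\mathbb{Z}$ and $M$ a positive integer depending on the series. A fractional power series is such a series with no negative powers of $z$. The equation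 $(w-1)^l - z w^{k+l}=0$ has $k+l$ solutions in $\mathbb{C}^{\mathrm{fra}}((z))$, of which exactly $l$ are fractional power series; these are $w_1,\dots,w_l$. A symmetric rational function is a rational function invariant under all permutations of its arguments. ''Computable'' means that for any values of the $k_i$ and $l_i$ the function $R$ can be computed effectively: a program can be written that on input $k_1,l_1,\dots,k_r,l_r$ outputs $R$. *)

(* Defs.v *)
From HB Require Import structures.
From mathcomp Require Import all_boot all_order all_algebra all_fingroup.
From mathcomp Require Import finmap boolp classical_sets functions cardinality.
From mathcomp Require Import fsbigop reals complex mpoly.

Set Implicit Arguments.
Unset Strict Implicit.
Unset Printing Implicit Defensive.

Import Order.TTheory GRing.Theory Num.Theory.

Local Open Scope ring_scope.

(* The family of coefficients [f] stands for the formal sum of the [f a z^a]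
   over the rational exponents [a]; the exponents that occur have a common
   denominator [M] and are bounded below by [m / M]. *)
Definition supp_in (F : nmodType) (M : nat) (m : int) (f : rat -> F) : Prop :=
  forall a, f a != 0 -> exists2 n : int, m <= n & a = n%:~R / M%:R.

Definition puiseux_axiom (F : nmodType) (f : rat -> F) : Prop :=
  exists (M : nat) (m : int), (0 < M)%N /\ supp_in M m f.

Record puiseux (F : nmodType) : Type :=
  Puiseux { pcoef :> rat -> F; _ : puiseux_axiom pcoef }.

HB.instance Definition _ (F : nmodType) := gen_eqMixin (puiseux F).
HB.instance Definition _ (F : nmodType) := gen_choiceMixin (puiseux F).

Lemma puiseuxP (F : nmodType) (f g : puiseux F) :
  (forall a, f a = g a) -> f = g.
Proof.
case: f g => [f Pf] [g Pg] /= /funext fg.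
by move: Pf; rewrite fg => Pf; congr Puiseux; exact: Prop_irrelevance.
Qed.

Lemma puiseux_valP (F : nmodType) (f : puiseux F) : puiseux_axiom f.
Proof. by case: f. Qed.

Section Common.
Variable F : nmodType.
Implicit Types (f g h : rat -> F).

Lemma supp_in_widen (M N : nat) (m m' : int) f : (0 < N)%N ->
  m' <= m * N%:Z -> supp_in M m f -> supp_in (M * N) m' f.
Proof.
move=> N0 mm' Hf a /Hf[n mn ->]; exists (n * N%:Z).
  by apply: le_trans mm' _; rewrite ler_wpM2r.
rewrite natrM intrM -mulf_div divff ?mulr1 //.
by rewrite pnatr_eq0 -lt0n.
Qed.

Lemma supp_common2 f g : puiseux_axiom f -> puiseux_axiom g ->
  exists (M : nat) (m : int), [/\ (0 < M)%N, supp_in M m f & supp_in M m g].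
Proof.
move=> [M1 [m1 [M10 H1]]] [M2 [m2 [M20 H2]]].
exists (M1 * M2)%N, (Num.min (m1 * M2%:Z) (m2 * M1%:Z)); split.
- by rewrite muln_gt0 M10.
- by apply: supp_in_widen H1; rewrite // ge_min lexx.
- by rewrite mulnC; apply: supp_in_widen H2; rewrite // ge_min lexx orbT.
Qed.

Lemma supp_common3 f g h :
  puiseux_axiom f -> puiseux_axiom g -> puiseux_axiom h ->
  exists (M : nat) (m : int),
    [/\ (0 < M)%N, supp_in M m f, supp_in M m g & supp_in M m h].
Proof.
move=> Pf Pg [M2 [m2 [M20 H2]]].
have [M1 [m1 [M10 H1 H1']]] := supp_common2 Pf Pg.
exists (M1 * M2)%N, (Num.min (m1 * M2%:Z) (m2 * M1%:Z)); split.
- by rewrite muln_gt0 M10.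
- by apply: supp_in_widen H1; rewrite // ge_min lexx.
- by apply: supp_in_widen H1'; rewrite // ge_min lexx.
- by rewrite mulnC; apply: supp_in_widen H2; rewrite // ge_min lexx orbT.
Qed.

(* [laurent M m s] is the series of the [s j * z ^ ((m + j) / M)] *)
Definition laurent (M : nat) (m : int) (s : nat -> F) : rat -> F := fun a =>
  let b := a * M%:R - m%:~R in
  if b \is a Num.nat then s (Num.truncn b) else 0.

Definition lexp (M : nat) (m : int) (j : nat) : rat := (m + j%:Z)%:~R / M%:R.

Lemma lexp_inj M m : (0 < M)%N -> injective (lexp M m).
Proof.
move=> M0 i j; rewrite /lexp => H.
have MV : (M%:R : rat)^-1 != 0 by rewrite invr_eq0 pnatr_eq0 -lt0n.
by have /(@intr_inj rat)/addrI[] := mulIf MV H.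
Qed.

Lemma laurentE M m s j : (0 < M)%N -> laurent M m s (lexp M m j) = s j.
Proof.
move=> M0; rewrite /laurent /lexp divfK ?pnatr_eq0 -?lt0n //.
have -> : (m + j%:Z)%:~R - m%:~R = j%:R :> rat.
  by rewrite rmorphD /= addrC addKr.
by rewrite natr_nat natrK.
Qed.

Lemma laurent_supp M m s a : (0 < M)%N -> laurent M m s a != 0 ->
  exists j, a = lexp M m j.
Proof.
move=> M0; rewrite /laurent; case: ifP => [/natrP[j Hj] _|]; last by rewrite eqxx.
exists j; rewrite /lexp rmorphD /= -[(j%:Z)%:~R]/(j%:R) -Hj addrC subrK.
by rewrite mulfK // pnatr_eq0 -lt0n.
Qed.

Lemma laurent_axiom M m s : (0 < M)%N -> supp_in M m (laurent M m s).
Proof.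
move=> M0 a /(laurent_supp M0)[j ->]; exists (m + j%:Z) => //.
by rewrite lerDl.
Qed.

Lemma laurent_repr M m f : (0 < M)%N -> supp_in M m f ->
  f = laurent M m (fun j => f (lexp M m j)).
Proof.
move=> M0 Hf; apply/funext => a.
have [[j ->]|nj] := pselect (exists j, a = lexp M m j).
  by rewrite laurentE.
transitivity (0 : F).
  apply/eqP; apply: contra_notT nj => /Hf[n mn ->].
  exists (`|n - m|)%N; rewrite /lexp.
  by rewrite gez0_abs ?subr_ge0 // addrCA subrr addr0.
apply/eqP; rewrite eq_sym; apply: contra_notT nj.
exact: laurent_supp.
Qed.
End Common.

Section Zmodule.
Variable F : zmodType.
Implicit Types (f g h : puiseux F).

Lemma pzero_axiom : puiseux_axiom (fun _ : rat => 0 : F).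
Proof. by exists 1%N, 0; split => // a; rewrite eqxx. Qed.
Definition pzero := Puiseux pzero_axiom.

Lemma popp_axiom f : puiseux_axiom (fun a => - f a).
Proof.
case: f => f [M [m [M0 Hf]]] /=; exists M, m; split => // a.
by rewrite oppr_eq0; exact: Hf.
Qed.
Definition popp f := Puiseux (popp_axiom f).

Lemma padd_axiom f g : puiseux_axiom (fun a => f a + g a).
Proof.
have [M [m [M0 Hf Hg]]] := supp_common2 (puiseux_valP f) (puiseux_valP g).
exists M, m; split => // a; have [fa0|/Hf //] := eqVneq (f a) 0.
by rewrite fa0 add0r; exact: Hg.
Qed.
Definition padd f g := Puiseux (padd_axiom f g).

Lemma paddA : associative padd.
Proof. by move=> f g h; apply: puiseuxP => a /=; rewrite addrA. Qed.
Lemma paddC : commutative padd.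
Proof. by move=> f g; apply: puiseuxP => a /=; rewrite addrC. Qed.
Lemma padd0 : left_id pzero padd.
Proof. by move=> f; apply: puiseuxP => a /=; rewrite add0r. Qed.
Lemma paddN : left_inverse pzero popp padd.
Proof. by move=> f; apply: puiseuxP => a /=; rewrite addNr. Qed.

HB.instance Definition _ :=
  GRing.isZmodule.Build (puiseux F) paddA paddC padd0 paddN.
End Zmodule.

Section Ring.
Variable F : fieldType.
Implicit Types (f g h : puiseux F) (s t u : nat -> F).

Definition conv s t : nat -> F := fun j => \sum_(i < j.+1) s i * t (j - i)%N.

(* The sum ranges over the finitely many [b] at which the summand is nonzero *)
Definition pmul_coef (f g : rat -> F) : rat -> F := fun a =>
  \sum_(b \in [set: rat]) f b * g (a - b).

Lemma conv_poly s t N j : (j < N)%N ->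
  conv s t j = ((\poly_(i < N) s i) * (\poly_(i < N) t i))`_j.
Proof.
move=> jN; rewrite coefM; apply: eq_bigr => i _; rewrite !coef_poly.
have iN : (i < N)%N by rewrite (leq_ltn_trans _ jN) // -ltnS.
by rewrite iN (leq_ltn_trans (leq_subr _ _) jN).
Qed.

Lemma convC s t : conv s t = conv t s.
Proof. by apply/funext => j; rewrite !(@conv_poly _ _ j.+1) // mulrC. Qed.

Lemma convA s t u : conv s (conv t u) = conv (conv s t) u.
Proof.
apply/funext => j.
set p := \poly_(i < j.+1) s i; set q := \poly_(i < j.+1) t i.
set r := \poly_(i < j.+1) u i.
transitivity ((p * (q * r))`_j).
  rewrite coefM; apply: eq_bigr => i _.
  rewrite -conv_poly; last by rewrite ltnS leq_subr.
  by rewrite coef_poly ltn_ord.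
rewrite mulrA coefM; apply: eq_bigr => i _.
by rewrite -conv_poly // coef_poly ltnS leq_subr.
Qed.

Lemma convDl s t u :
  conv (fun j => s j + t j) u = (fun j => conv s u j + conv t u j).
Proof.
apply/funext => j; rewrite /conv -big_split /=.
by apply: eq_bigr => i _; rewrite mulrDl.
Qed.

Lemma laurentD M m s t : (0 < M)%N ->
  laurent M m (fun j => s j + t j) =
  (fun a => laurent M m s a + laurent M m t a).
Proof.
by move=> M0; apply/funext => a; rewrite /laurent; case: ifP; rewrite ?addr0.
Qed.

Lemma lexpB M m m' j i : (i <= j)%N ->
  lexp M (m + m') j - lexp M m i = lexp M m' (j - i).
Proof.
move=> ij; rewrite /lexp -mulrBl -rmorphB /=; congr (_%:~R / _).
by rewrite -subzn // opprD addrACA [m + m']addrC addrK addrA.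
Qed.

Lemma lexpD M m m' i j : lexp M m i + lexp M m' j = lexp M (m + m') (i + j).
Proof. by rewrite /lexp -mulrDl -rmorphD /= PoszD addrACA. Qed.

Lemma laurentM M m m' s t : (0 < M)%N ->
  pmul_coef (laurent M m s) (laurent M m' t) =
  laurent M (m + m') (conv s t).
Proof.
move=> M0; apply/funext => a; rewrite /pmul_coef.
have supp b : laurent M m s b * laurent M m' t (a - b) != 0 ->
    exists i k, b = lexp M m i /\ a = lexp M (m + m') (i + k).
  rewrite mulf_eq0 negb_or => /andP[/(laurent_supp M0)[i bi]].
  move=> /(laurent_supp M0)[k ak]; exists i, k; split=> //.
  by rewrite -lexpD -bi -ak addrC subrK.
have [[j aj]|nj] := pselect (exists j, a = lexp M (m + m') j); last first.
  rewrite fsbig1 => [|b _].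
    apply/eqP; rewrite eq_sym; apply: contra_notT nj.
    exact: laurent_supp.
  apply/eqP; apply: contra_notT nj => /supp[i [k [_ ak]]].
  by exists (i + k)%N.
rewrite (fsbigE [seq lexp M m i | i <- iota 0 j.+1]) //.
- rewrite big_map -{1}[j.+1]subn0 -/(index_iota 0 j.+1) big_mkord.
  rewrite aj laurentE //; apply: eq_big => [i|i _]; first by rewrite in_setT.
  by rewrite lexpB ?laurentE // -ltnS.
- by rewrite map_inj_uniq ?iota_uniq //; exact: lexp_inj.
- move=> b _ bj; apply/eqP; apply: contraNT bj => /supp[i [k [-> ak]]].
  apply: map_f; rewrite mem_iota add0n ltnS.
  move: ak; rewrite aj => /(lexp_inj M0) ->; exact: leq_addr.
Qed.

Lemma pmul_axiom f g : puiseux_axiom (pmul_coef f g).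
Proof.
have [M [m [M0 Hf Hg]]] := supp_common2 (puiseux_valP f) (puiseux_valP g).
rewrite (laurent_repr M0 Hf) (laurent_repr M0 Hg) laurentM //.
by exists M, (m + m); split=> //; exact: laurent_axiom.
Qed.
Definition pmul f g := Puiseux (pmul_axiom f g).

Lemma pone_axiom : puiseux_axiom (fun a : rat => (a == 0)%:R : F).
Proof.
exists 1%N, 0; split=> // a; have [-> _|] := eqVneq a 0; last by rewrite eqxx.
by exists 0; rewrite ?mul0r.
Qed.
Definition pone := Puiseux pone_axiom.

Lemma pmulC : commutative pmul.
Proof.
move=> f g; apply: puiseuxP => a /=; move: a; apply/funeqP.
have [M [m [M0 Hf Hg]]] := supp_common2 (puiseux_valP f) (puiseux_valP g).
rewrite (laurent_repr M0 Hf) (laurent_repr M0 Hg) !laurentM //.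
by rewrite convC.
Qed.

Lemma pmulA : associative pmul.
Proof.
move=> f g h; apply: puiseuxP => a /=; move: a; apply/funeqP.
have [M [m [M0 Hf Hg Hh]]] :=
  supp_common3 (puiseux_valP f) (puiseux_valP g) (puiseux_valP h).
rewrite (laurent_repr M0 Hf) (laurent_repr M0 Hg) (laurent_repr M0 Hh).
by rewrite !laurentM // convA addrA.
Qed.

Lemma pmul1 : left_id pone pmul.
Proof.
move=> f; apply: puiseuxP => a /=; rewrite /pmul_coef.
rewrite (fsbigE [:: 0]) //= => [|b _].
  by rewrite big_cons big_nil in_setT eqxx mul1r subr0 addr0.
by rewrite inE => /negPf ->; rewrite mul0r.
Qed.

Lemma pmulDl : left_distributive pmul (@padd F).
Proof.
move=> f g h; apply: puiseuxP => a /=; move: a; apply/funeqP.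
have [M [m [M0 Hf Hg Hh]]] :=
  supp_common3 (puiseux_valP f) (puiseux_valP g) (puiseux_valP h).
rewrite (laurent_repr M0 Hf) (laurent_repr M0 Hg) (laurent_repr M0 Hh).
by rewrite -laurentD // !laurentM // convDl -laurentD.
Qed.

Lemma pone_neq0 : pone != pzero F.
Proof.
apply/eqP => /(congr1 (fun f : puiseux F => f 0)) /eqP.
by rewrite oner_eq0.
Qed.

HB.instance Definition _ := GRing.Zmodule_isComNzRing.Build (puiseux F)
  pmulA pmulC pmul1 pmulDl pone_neq0.

Fixpoint convinv_seq s (n : nat) : seq F :=
  if n is n'.+1 then
    let r := convinv_seq s n' in
    rcons r ((s 0%N)^-1 *
      ((n' == 0%N)%:R - \sum_(i < n') s i.+1 * r`_(n' - i.+1)))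
  else [::].

Lemma size_convinv s n : size (convinv_seq s n) = n.
Proof. by elim: n => //= n IHn; rewrite size_rcons IHn. Qed.

Lemma nth_convinv s n j : (j < n)%N ->
  (convinv_seq s n)`_j = (convinv_seq s j.+1)`_j.
Proof.
elim: n => // n IHn; rewrite ltnS leq_eqVlt => /orP[/eqP -> //|jn].
by rewrite -IHn //= nth_rcons size_convinv jn.
Qed.

Lemma convV s : s 0%N != 0 ->
  exists t, conv s t = (fun j => (j == 0%N)%:R).
Proof.
move=> s0; exists (fun j => (convinv_seq s j.+1)`_j); apply/funext => j.
rewrite /conv big_ord_recl /= subn0 nth_rcons size_convinv ltnn eqxx.
rewrite mulVKf //; apply/eqP; rewrite addrAC subr_eq; apply/eqP.
congr (_ + _); apply: eq_bigr => i _; congr (_ * _).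
rewrite /bump /= add1n; apply/esym/nth_convinv.
by rewrite ltn_subrL /= (leq_trans _ (ltn_ord i)).
Qed.

Lemma pinv_ex f : f != 0 -> exists g, g * f = 1.
Proof.
move=> f0; have [M [m [M0 Hf]]] := puiseux_valP f.
have fE := laurent_repr M0 Hf; set s := (fun j => _) in fE.
have [j sj] : exists j, s j != 0.
  apply: contrapT => sz; case/eqP: f0; apply: puiseuxP => a.
  rewrite fE /laurent; case: ifP => // _; apply: contrapT => /eqP nz.
  by apply: sz; eexists; exact: nz.
pose P i := s i != 0; have exP : exists i, P i by exists j.
case: (ex_minnP exP) => i0 si0 mini.
have supp0 : supp_in M (m + i0%:Z) f.
  move=> a fa; have [n mn an] := Hf a fa; exists n => //.
  rewrite -lerBrDl -[n - m]gez0_abs ?subr_ge0 // lez_nat; apply: mini.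
  rewrite /P /s /lexp gez0_abs ?subr_ge0 // addrCA subrr addr0 -an.
  exact: fa.
have fE' := laurent_repr M0 supp0; set s' := (fun j => _) in fE'.
have [|t st] := @convV s'; first by rewrite /s' /lexp addr0.
have P1 : puiseux_axiom (laurent M (- (m + i0%:Z)) t).
  by exists M, (- (m + i0%:Z)); split=> //; exact: laurent_axiom.
exists (Puiseux P1); rewrite mulrC; apply: puiseuxP => a.
rewrite [LHS]/= fE' laurentM // st subrr.
rewrite /laurent subr0; apply/esym; rewrite [LHS]/=.
have M0' : (M%:R : rat) != 0 by rewrite pnatr_eq0 -lt0n.
case: ifP => [aM|].
  by rewrite -(eqr_nat rat) truncnK // mulf_eq0 (negPf M0') orbF.
by case: eqVneq => // ->; rewrite mul0r.
Qed.

Definition pinv f : puiseux F :=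
  if pselect (exists g, g * f = 1) is left ex then projT1 (cid ex) else 0.

Lemma pmulVf f : f != 0 -> pinv f * f = 1.
Proof.
move=> /pinv_ex ex; rewrite /pinv; case: pselect => // ex'.
by case: cid.
Qed.

Lemma pinv0 : pinv 0 = 0.
Proof.
rewrite /pinv; case: pselect => // ex; exfalso; case: ex => g /eqP.
by rewrite mulr0 eq_sym oner_eq0.
Qed.

HB.instance Definition _ :=
  GRing.ComNzRing_isField.Build (puiseux F) pmulVf pinv0.
End Ring.

Section Series.
Variable F : fieldType.

Lemma pz_axiom : puiseux_axiom (fun a : rat => (a == 1)%:R : F).
Proof.
exists 1%N, 0; split=> // a; have [-> _|] := eqVneq a 1; last by rewrite eqxx.
by exists 1; rewrite ?divr1.
Qed.
Definition pz : puiseux F := Puiseux pz_axiom.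

Lemma pseries_axiom (u : nat -> F) : puiseux_axiom
  (fun a : rat => if a \is a Num.nat then u (Num.truncn a) else 0).
Proof.
exists 1%N, 0; split=> // a; case: ifP => [/natrP[n ->] _|]; last by rewrite eqxx.
by exists n%:Z; rewrite ?divr1.
Qed.
Definition pseries (u : nat -> F) : puiseux F := Puiseux (pseries_axiom u).

Definition fractional_power_series (f : puiseux F) : Prop :=
  forall a : rat, a < 0 -> f a = 0.

Definition fps_solutions (k l : nat) (w : 'I_l -> puiseux F) : Prop :=
  injective w /\
  forall x : puiseux F,
    (fractional_power_series x /\ (x - 1) ^+ l - pz * x ^+ (k + l) = 0) <->
    exists i : 'I_l, x = w i.
End Series.

Definition step := bool.
Definition stepN : step := true.
Definition stepE : step := false.

Definition endpoint (p : seq step) : nat * nat :=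
  (count_mem stepE p, count_mem stepN p).

Definition points (p : seq step) : seq (nat * nat) :=
  [seq endpoint (take i p) | i <- iota 0 (size p).+1].

(* On a vertical line that [P] meets in a segment, strictly above [P] means
   above the top of that segment. *)
Definition strictly_above (P : seq step) (u : nat * nat) : bool :=
  all (fun v => (v.1 == u.1) ==> (v.2 < u.2)%N) (points P).

(* If a point of [p] is strictly above [P], so is one of its lattice points. *)
Definition never_above (P p : seq step) : bool :=
  ~~ has (strictly_above P) (points p).

(* The sequence [s] lists the pairs (k_1, l_1), ..., (k_r, l_r). *)
Definition period (s : seq (nat * nat)) : seq step :=
  flatten [seq nseq x.1 stepN ++ nseq x.2 stepE | x <- s].

Definition boundary (s : seq (nat * nat)) (n : nat) : seq step :=
  flatten (nseq n (period s)).

Definition ksum (s : seq (nat * nat)) : nat := \sum_(x <- s) x.1.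
Definition lsum (s : seq (nat * nat)) : nat := \sum_(x <- s) x.2.

(* A path to [(a, b)] has [a + b] steps, whence the tuples. *)
Definition npaths (s : seq (nat * nat)) (n : nat) : nat :=
  #|[set p : (lsum s * n + ksum s * n).-tuple step |
      (endpoint p == (lsum s * n, ksum s * n)%N) &&
      never_above (boundary s n) p]|.

(* The Turing-complete language I of N. D. Jones, "Computability and Complexity
   from a Programming Perspective" (MIT Press, 1997): while-programs with a
   single variable, which ranges over binary trees. *)
Inductive tree : Type := Nil | Cons of tree & tree.

Definition hd (t : tree) : tree := if t is Cons a _ then a else Nil.
Definition tl (t : tree) : tree := if t is Cons _ b then b else Nil.

Inductive expr : Type :=
  | EVar
  | ENil
  | ECons of expr & expr
  | EHd of expr
  | ETl of expr.

Fixpoint eval (e : expr) (x : tree) : tree :=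
  match e with
  | EVar => x
  | ENil => Nil
  | ECons e1 e2 => Cons (eval e1 x) (eval e2 x)
  | EHd e1 => hd (eval e1 x)
  | ETl e1 => tl (eval e1 x)
  end.

Inductive prog : Type :=
  | Assign of expr
  | Comp of prog & prog
  | While of expr & prog.

Inductive runs : prog -> tree -> tree -> Prop :=
  | RunAssign e x : runs (Assign e) x (eval e x)
  | RunComp p q x y z : runs p x y -> runs q y z -> runs (Comp p q) x z
  | RunWhileEnd e p x : eval e x = Nil -> runs (While e p) x x
  | RunWhileLoop e p x y z : eval e x <> Nil -> runs p x y ->
      runs (While e p) y z -> runs (While e p) x z.

Definition enc_nat (n : nat) : tree := iter n (Cons Nil) Nil.

Definition enc_int (m : int) : tree :=
  match m with
  | Posz n => Cons Nil (enc_nat n)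
  | Negz n => Cons (Cons Nil Nil) (enc_nat n)
  end.

Definition enc_seq (T : Type) (enc : T -> tree) (s : seq T) : tree :=
  foldr (fun x t => Cons (enc x) t) Nil s.

Definition enc_pair (T U : Type) (encT : T -> tree) (encU : U -> tree)
    (x : T * U) : tree :=
  Cons (encT x.1) (encU x.2).

Definition enc_input : seq (nat * nat) -> tree :=
  enc_seq (enc_pair enc_nat enc_nat).

(* A polynomial is written as a list of terms (coefficient, exponents). *)
Definition terms : Type := seq (int * seq nat).

Definition poly_of (n : nat) (c : terms) : {mpoly int[n]} :=
  \sum_(t <- c) t.1 *: 'X_[[multinom nth 0%N t.2 i | i < n]].

Definition enc_terms : terms -> tree :=
  enc_seq (enc_pair enc_int (enc_seq enc_nat)).

(* A fraction [(A, B)] of polynomials stands for the rational function [A / B];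
   symmetry is the equality [A^s / B^s = A / B] of rational functions. *)
Definition symmetric_ratfun (n : nat) (R : {mpoly int[n]} * {mpoly int[n]}) :
    Prop :=
  R.2 != 0 /\ forall s : {perm 'I_n}, msym s R.1 * R.2 = R.1 * msym s R.2.

(* The value of [A / B] at [w] is defined when [B(w) != 0]. *)
Definition ratfun_defined (n : nat) (K : fieldType)
    (R : {mpoly int[n]} * {mpoly int[n]}) (w : 'I_n -> K) : Prop :=
  mmap intr w R.2 != 0.

Definition ratfun_eval (n : nat) (K : fieldType)
    (R : {mpoly int[n]} * {mpoly int[n]}) (w : 'I_n -> K) : K :=
  mmap intr w R.1 / mmap intr w R.2.

(* Main.v *)
Require Import Defs.
From HB Require Import structures.
From mathcomp Require Import all_boot all_order all_algebra all_fingroup.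
From mathcomp Require Import zify ring.
From mathcomp Require Import boolp classical_sets fsbigop reals.
From mathcomp Require Import complex mpoly.

(* Kernel method. Let A_n(u) count the paths that stay below n periods and reach
   the last vertical line by an E step (A_0 = 1), the power of u being the
   distance to the top; hence q_n = A_n(1).
   A letter N of the boundary multiplies A_n by u; a letter E replaces it by
   (u A(u) - A(1)) / (u - 1). Over one period with word W this gives
     (u - 1)^l A_(n+1)(u)
       = u^(k+l) A_n(u) - sum_j (u - 1)^j u^(e_j) B_(n,j),
   where e_j is the number of letters of W after its j-th E, and B_(n,j) is the
   value at 1 of the series just before that letter, so that B_(n,0) = q_n.
   Summing over n and putting u = w_i kills the left-hand side:
     z sum_j (w_i - 1)^j w_i^(e_j) B_j(z) = (w_i - 1)^l    (1 <= i <= l).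
   Cramer's rule gives z Q as a quotient of two determinants. The denominator
   is nonzero because modulo the maximal ideal of the fractional power series
   w_i = 1, while u^(e_j) (u - 1)^j has order exactly j at 1. The determinants
   are expanded into terms with coefficients 1 and -1 by repeated Laplace
   expansion along the first column, which is iteration over lists and hence
   can be compiled into a while-program. *)

Set Implicit Arguments.
Unset Strict Implicit.
Unset Printing Implicit Defensive.

Import Order.TTheory GRing.Theory Num.Theory.
Local Open Scope ring_scope.

(** * Functions computed by while-programs *)

Class encoding (A : Type) := encode : A -> tree.

#[local] Instance encoding_unit : encoding unit := fun _ => Defs.Nil.
#[local] Instance encoding_bool : encoding bool := fun b => enc_nat b.
#[local] Instance encoding_nat : encoding nat := enc_nat.
#[local] Instance encoding_int : encoding int := enc_int.
#[local] Instance encoding_prod A B (eA : encoding A) (eB : encoding B) :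
  encoding (A * B) := enc_pair eA eB.
#[local] Instance encoding_seq A (eA : encoding A) : encoding (seq A) :=
  enc_seq eA.

Definition computable A B (eA : encoding A) (eB : encoding B) (f : A -> B) :=
  exists p, forall a, runs p (encode a) (encode (f a)).
Arguments computable {A B eA eB} f.

Fixpoint on_hd_expr (e : expr) : expr :=
  match e with
  | EVar => EHd EVar
  | ENil => ENil
  | ECons e1 e2 => ECons (on_hd_expr e1) (on_hd_expr e2)
  | EHd e1 => EHd (on_hd_expr e1)
  | ETl e1 => ETl (on_hd_expr e1)
  end.

(* Runs [p] on the head of the store, the tail of which keeps a saved value. *)
Fixpoint on_hd (p : prog) : prog :=
  match p with
  | Assign e => Assign (ECons (on_hd_expr e) (ETl EVar))
  | Comp p q => Comp (on_hd p) (on_hd q)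
  | While e p => While (on_hd_expr e) (on_hd p)
  end.

Lemma eval_on_hd e x y : eval (on_hd_expr e) (Defs.Cons x y) = eval e x.
Proof. by elim: e => //= [e1 -> e2 ->|e1 ->|e1 ->]. Qed.

Lemma runs_on_hd p x x' y :
  runs p x x' -> runs (on_hd p) (Defs.Cons x y) (Defs.Cons x' y).
Proof.
elim=> {p x x'} /=
  [e x|p q x x1 x2 _ IHp _ IHq|e p x e0|e p x x1 x2 e0 _ IHp _ IHw].
- by rewrite -(eval_on_hd e x y); exact: RunAssign.
- exact: RunComp IHp IHq.
- by apply: RunWhileEnd; rewrite eval_on_hd.
- by apply: RunWhileLoop IHp IHw; rewrite eval_on_hd.
Qed.

Fixpoint tree_expr (t : tree) : expr :=
  if t is Defs.Cons a b then ECons (tree_expr a) (tree_expr b) else ENil.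

Lemma eval_tree t x : eval (tree_expr t) x = t.
Proof. by elim: t => //= a -> b ->. Qed.

Lemma runs_assign e x y : eval e x = y -> runs (Assign e) x y.
Proof. by move=> <-; exact: RunAssign. Qed.

Generalizable Variables A B C.

Lemma computable_expr `{eA : encoding A} `{eB : encoding B} (f : A -> B) e :
  (forall a, eval e (encode a) = encode (f a)) -> computable f.
Proof. by move=> fE; exists (Assign e) => a; exact: runs_assign. Qed.

Lemma computable_id `{eA : encoding A} : computable (fun a : A => a).
Proof. by exists (Assign EVar) => a; exact: runs_assign. Qed.

Lemma computable_const `{eA : encoding A} `{eB : encoding B}
    (b : B) :
  computable (fun _ : A => b).
Proof.
by apply: (computable_expr (e := tree_expr (encode b))) => a;
  exact: eval_tree.
Qed.

Lemma computable_comp `{eA : encoding A} `{eB : encoding B} `{eC : encoding C}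
    (f : A -> B) (g : B -> C) :
  computable f -> computable g -> computable (fun a => g (f a)).
Proof.
by move=> [p fP] [q gP]; exists (Comp p q) => a;
  exact: RunComp (fP a) (gP _).
Qed.

(** The input is doubled: [q] runs on one copy while the tail saves the other, and after a swap [p]
    runs on the saved copy. *)
Lemma computable_pair `{eA : encoding A} `{eB : encoding B} `{eC : encoding C}
    (f : A -> B) (g : A -> C) :
  computable f -> computable g -> computable (fun a => (f a, g a)).
Proof.
move=> [p fP] [q gP].
pose swap := Assign (ECons (ETl EVar) (EHd EVar)).
exists (Comp (Assign (ECons EVar EVar))
  (Comp (on_hd q) (Comp swap (on_hd p)))) => a.
apply: RunComp; first exact: runs_assign.
apply: RunComp; first exact: runs_on_hd (gP a).
by apply: RunComp (runs_on_hd _ (fP a)); exact: runs_assign.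
Qed.

Lemma computable_fst `{eA : encoding A} `{eB : encoding B} `{eC : encoding C}
    (f : A -> B * C) :
  computable f -> computable (fun a => (f a).1).
Proof.
move=> cf; apply: (computable_comp cf).
by exists (Assign (EHd EVar)) => -[b c]; exact: runs_assign.
Qed.

Lemma computable_snd `{eA : encoding A} `{eB : encoding B} `{eC : encoding C}
    (f : A -> B * C) :
  computable f -> computable (fun a => (f a).2).
Proof.
move=> cf; apply: (computable_comp cf).
by exists (Assign (ETl EVar)) => -[b c]; exact: runs_assign.
Qed.

Lemma computable_cons `{eA : encoding A} `{eB : encoding B}
    (f : A -> B) (g : A -> seq B) :
  computable f -> computable g -> computable (fun a => f a :: g a).
Proof.
move=> cf cg; apply: (computable_comp (g := fun x => x.1 :: x.2)
  (computable_pair cf cg)).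
by exists (Assign EVar) => -[b c]; exact: runs_assign.
Qed.

Lemma computable_behead `{eA : encoding A} `{eB : encoding B} (f : A -> seq B) :
  computable f -> computable (fun a => behead (f a)).
Proof.
move=> cf; apply: (computable_comp cf).
by exists (Assign (ETl EVar)) => -[|b c]; exact: runs_assign.
Qed.

Lemma computable_succ `{eA : encoding A} (f : A -> nat) :
  computable f -> computable (fun a => (f a).+1).
Proof.
move=> cf; apply: (computable_comp cf).
by exists (Assign (ECons ENil EVar)) => n; exact: runs_assign.
Qed.

(** A number and the list of as many units are encoded by the same tree, so the identity program
    does; this turns [iter] into a fold. *)
Lemma computable_nseq `{eA : encoding A} (f : A -> nat) :
  computable f -> computable (fun a => nseq (f a) tt).
Proof.
move=> cf; apply: (computable_comp cf).
exists (Assign EVar) => n; apply: runs_assign.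
by elim: n => //= n; rewrite /encode /= => ->.
Qed.

Lemma computable_nat_of_bool `{eA : encoding A} (f : A -> bool) :
  computable f -> computable (fun a => nat_of_bool (f a)).
Proof.
move=> cf; apply: (computable_comp cf).
by exists (Assign EVar) => n; exact: runs_assign.
Qed.

Lemma computable_foldl `{eA : encoding A} `{eB : encoding B} `{eC : encoding C}
    (f : A -> seq B) (g : A -> C) (h : A -> C -> B -> C) :
  computable f -> computable g ->
  computable (fun t : A * C * B => h t.1.1 t.1.2 t.2) ->
  computable (fun a => foldl (h a) (g a) (f a)).
Proof.
move=> cf cg [p hP].
have [q qP] := computable_pair computable_id (computable_pair cf cg).
(* The state of the loop is [(a, (unread part of the list, accumulator))]. *)
pose st := ETl EVar.
(* The first assignment brings the arguments of [h] to the head and keeps [a] and the rest of the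
   list in the tail, so that [on_hd p] can run; the last one restores the shape of the state. *)
pose body := Comp
  (Assign (ECons (ECons (ECons (EHd EVar) (ETl st)) (EHd (EHd st)))
                 (ECons (EHd EVar) (ETl (EHd st)))))
  (Comp (on_hd p)
  (Assign (ECons (EHd st) (ECons (ETl st) (EHd EVar))))).
exists (Comp q (Comp (While (EHd st) body) (Assign (ETl st)))) => a.
apply: RunComp (qP a) _.
apply: (@RunComp _ _ _ (Defs.Cons (encode a)
  (Defs.Cons Defs.Nil (encode (foldl (h a) (g a) (f a))))));
    last exact: runs_assign.
elim: (f a) (g a) => [|b s IHs] c /=; first exact: RunWhileEnd.
apply: RunWhileLoop (IHs _) => //.
apply: RunComp; first exact: runs_assign.
apply: RunComp; first exact: runs_on_hd (hP (a, c, b)).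
exact: runs_assign.
Qed.

Lemma computable_rev `{eA : encoding A} `{eB : encoding B} (f : A -> seq B) :
  computable f -> computable (fun a => rev (f a)).
Proof.
move=> cf; have -> : (fun a => rev (f a)) =
    (fun a => foldl (fun s b => b :: s) [::] (f a)).
  apply/funext => a; rewrite -[in RHS](revK (f a)) foldl_rev.
  by elim: (rev _) => //= b s <-.
apply: (computable_foldl (h := fun _ s b => b :: s)) cf (computable_const _) _.
apply: computable_cons; first exact: computable_snd computable_id.
exact: computable_snd (computable_fst computable_id).
Qed.

Lemma computable_foldr `{eA : encoding A} `{eB : encoding B} `{eC : encoding C}
    (f : A -> seq B) (g : A -> C) (h : A -> B -> C -> C) :
  computable f -> computable g ->
  computable (fun t : A * B * C => h t.1.1 t.1.2 t.2) ->
  computable (fun a => foldr (h a) (g a) (f a)).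
Proof.
move=> cf cg ch.
have -> : (fun a => foldr (h a) (g a) (f a)) =
    (fun a => foldl (fun c b => h a b c) (g a) (rev (f a))).
  by apply/funext => a; rewrite foldl_rev.
apply: computable_foldl (computable_rev cf) cg _.
have ct : computable (fun t : A * C * B => (t.1.1, t.2, t.1.2)).
  by apply: computable_expr (ECons (ECons (EHd (EHd EVar)) (ETl EVar))
    (ETl (EHd EVar))) _.
exact: computable_comp ct ch.
Qed.

Lemma computable_iter `{eA : encoding A} `{eB : encoding B}
    (f : A -> nat) (g : A -> B) (h : A -> B -> B) :
  computable f -> computable g ->
  computable (fun t : A * B => h t.1 t.2) ->
  computable (fun a => iter (f a) (h a) (g a)).
Proof.
move=> cf cg ch; have -> : (fun a => iter (f a) (h a) (g a)) =
    (fun a => foldr (fun _ => h a) (g a) (nseq (f a) tt)).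
  by apply/funext => a; elim: (f a) => //= n ->.
apply: (computable_foldr (h := fun a _ => h a) (computable_nseq cf) cg).
have ct : computable (fun t : A * unit * B => (t.1.1, t.2)).
  by apply: computable_expr (ECons (EHd (EHd EVar)) (ETl EVar)) _.
exact: computable_comp ct ch.
Qed.

(** A boolean is stored as 0 or 1, so a conditional iterates the constant map to [g a] that many
    times, starting from [h a]. *)
Lemma computable_if `{eA : encoding A} `{eB : encoding B}
    (f : A -> bool) (g h : A -> B) :
  computable f -> computable g -> computable h ->
  computable (fun a => if f a then g a else h a).
Proof.
move=> cf cg ch; have -> : (fun a => if f a then g a else h a) =
    (fun a => iter (f a) (fun _ => g a) (h a)).
  by apply/funext => a; case: (f a).
apply: (computable_iter (h := fun a _ => g a)) ch _.
  exact: computable_nat_of_bool.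
exact: computable_comp (computable_fst computable_id) cg.
Qed.

Lemma computable_negb `{eA : encoding A} (f : A -> bool) :
  computable f -> computable (fun a => ~~ f a).
Proof. by move=> cf; apply: computable_if => //; exact: computable_const. Qed.

Lemma computable_addb `{eA : encoding A} (f g : A -> bool) :
  computable f -> computable g -> computable (fun a => f a (+) g a).
Proof.
move=> cf cg; have -> : (fun a => f a (+) g a) =
    (fun a => if f a then ~~ g a else g a).
  by apply/funext => a; case: (f a).
by apply: computable_if => //; exact: computable_negb.
Qed.

Lemma computable_map `{eA : encoding A} `{eB : encoding B} `{eC : encoding C}
    (f : A -> seq B) (h : A -> B -> C) :
  computable f -> computable (fun t : A * B => h t.1 t.2) ->
  computable (fun a => map (h a) (f a)).
Proof.
move=> cf ch; apply: (computable_foldr (h := fun a b => cons (h a b))) => //.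
  exact: computable_const.
apply: computable_cons; last exact: computable_snd computable_id.
exact: computable_comp (computable_fst computable_id) ch.
Qed.

Lemma computable_cat `{eA : encoding A} `{eB : encoding B} (f g : A -> seq B) :
  computable f -> computable g -> computable (fun a => f a ++ g a).
Proof.
move=> cf cg; have -> : (fun a => f a ++ g a) =
    (fun a => foldr cons (g a) (f a)).
  by apply/funext => a; elim: (f a) => //= b s ->.
apply: (computable_foldr (h := fun _ => cons)) cf cg _.
apply: computable_cons; last exact: computable_snd computable_id.
exact: computable_snd (computable_fst computable_id).
Qed.

Lemma computable_flatten `{eA : encoding A} `{eB : encoding B}
    (f : A -> seq (seq B)) :
  computable f -> computable (fun a => flatten (f a)).
Proof.
move=> cf; apply: (computable_foldr (h := fun _ => cat)) cf _ _.
  exact: computable_const.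
apply: computable_cat; last exact: computable_snd computable_id.
exact: computable_snd (computable_fst computable_id).
Qed.

(** * The program and the determinants it outputs *)

(* [(b, m)] stands for [(-1) ^ b * x ^ m], and likewise for lists [m] of
   exponents. *)
Definition smono := (bool * nat)%type.
Definition sterm := (bool * seq nat)%type.

Definition mul_Xsub1 (c : seq smono) : seq smono :=
  [seq (t.1, t.2.+1) | t <- c] ++ [seq (~~ t.1, t.2) | t <- c].

(** Column j is to represent (x - 1)^j x^(e_j): each exponent put in front multiplies every column
    behind it once more by x - 1. *)
Definition columns (es : seq nat) : seq (seq smono) :=
  foldr (fun e cs => [:: (false, e)] :: map mul_Xsub1 cs) [::] es.

Definition rhs_column (es : seq nat) : seq smono :=
  foldr (fun _ => mul_Xsub1) [:: (false, 0%N)] es.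

(* The first component of the accumulator is the list traversed so far. *)
Definition insertions (m : nat) (e : seq nat) : seq sterm :=
  (foldr (fun a st => (a :: st.1,
     (false, [:: m, a & st.1]) :: [seq (~~ t.1, a :: t.2) | t <- st.2]))
   ([::], [:: (false, [:: m])]) e).2.

(** The minors left by the different rows of the first column agree up to renaming variables, so one
    recursive call serves all rows; [insertions] puts the variable of the removed row back. *)
Definition det_terms (cs : seq (seq smono)) : seq sterm :=
  foldr (fun c ts => flatten
      [seq flatten
        [seq [seq (b.1 (+) t.1 (+) u.1, u.2) | u <- insertions b.2 t.2]
          | t <- ts]
        | b <- c])
    [:: (false, [::])] cs.

Definition to_terms (ts : seq sterm) : terms :=
  [seq (if t.1 then Negz 0 else Posz 1, t.2) | t <- ts].

(** The word is read from its right end; the state holds the number of letters read so far and the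
    exponents of the E steps among them. *)
Definition east_exps_from (x : nat * nat) (st : nat * seq nat) :
    nat * seq nat :=
  iter x.1 (fun st => (st.1.+1, st.2))
    (iter x.2 (fun st => (st.1.+1, st.1 :: st.2)) st).

Definition east_exps (s : seq (nat * nat)) : seq nat :=
  (foldr east_exps_from (0%N, [::]) s).2.

(** Cramer's rule for the unknown of index 0, which is z Q(z): column 0 gives way to the right-hand
    side. *)
Definition ratfun_of (s : seq (nat * nat)) : terms * terms :=
  let es := east_exps s in
  (to_terms (det_terms (rhs_column es :: behead (columns es))),
   to_terms (det_terms (columns es))).

Ltac computable_tac := repeat match goal with
 | |- computable (fun x => x) => exact: computable_id
 | |- computable (fun _ => ?c) => exact: computable_const
 | |- computable (fun x => (_, _)) => apply: computable_pair
 | |- computable (fun x => _ :: _) => apply: computable_cons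
 | |- computable (fun x => (_).1) => apply: computable_fst
 | |- computable (fun x => (_).2) => apply: computable_snd
 | |- computable (fun x => (_).+1) => apply: computable_succ
 | |- computable (fun x => (_) ++ _) => apply: computable_cat
 | |- computable (fun x => ~~ _) => apply: computable_negb
 | |- computable (fun x => _ (+) _) => apply: computable_addb
 | |- computable (fun x => behead _) => apply: computable_behead
 | |- computable (fun x => if _ then _ else _) => apply: computable_if
 | |- computable (fun x => flatten _) => apply: computable_flatten
 | |- computable (fun x => map _ _) => apply: computable_map
 | |- computable (fun x => foldr _ _ _) => apply: computable_foldr
 | |- computable (fun x => iter _ _ _) => apply: computable_iter
 | |- computable fst => exact: computable_fst computable_id
 | |- computable snd => exact: computable_snd computable_id
 | |- computable (foldr ?h ?z) =>
     apply: (computable_foldr (f := id) (g := fun _ => z) (h := fun _ => h))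
 | |- computable id => exact: computable_id
 end.

Lemma computable_ratfun_of : computable ratfun_of.
Proof.
rewrite /ratfun_of /to_terms /det_terms /insertions /columns /rhs_column
  /mul_Xsub1 /east_exps /east_exps_from.
by cbv zeta; computable_tac.
Qed.

Section Values.
Variable K : comNzRingType.

Definition smono_val (x : K) (c : seq smono) : K :=
  \sum_(t <- c) (-1) ^+ t.1 * x ^+ t.2.

Definition monom n (x : 'I_n -> K) (e : seq nat) : K :=
  \prod_(i < n) x i ^+ nth 0%N e i.

Definition sterm_val n (x : 'I_n -> K) (ts : seq sterm) : K :=
  \sum_(t <- ts) (-1) ^+ t.1 * monom x t.2.

Lemma smono_val_mul_Xsub1 x c :
  smono_val x (mul_Xsub1 c) = (x - 1) * smono_val x c.
Proof.
rewrite /smono_val /mul_Xsub1 big_cat !big_map /= mulrBl mul1r; congr (_ + _).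
  by rewrite big_distrr; apply: eq_bigr => t _ /=; rewrite exprS mulrCA.
rewrite -sumrN; apply: eq_bigr => t _ /=.
by rewrite signrN mulNr.
Qed.

Lemma size_columns es : size (columns es) = size es.
Proof. by elim: es => //= e es IH; rewrite size_map IH. Qed.

Lemma smono_val_columns x es j : (j < size es)%N ->
  smono_val x (nth [::] (columns es) j) = (x - 1) ^+ j * x ^+ nth 0%N es j.
Proof.
elim: es j => // e es IH [_|j jes] /=.
  by rewrite /smono_val big_seq1 /= expr0.
rewrite (nth_map [::]) ?size_columns // smono_val_mul_Xsub1 IH //.
by rewrite exprS mulrA.
Qed.

Lemma smono_val_rhs x es : smono_val x (rhs_column es) = (x - 1) ^+ size es.
Proof.
elim: es => [|e es IH] /=; first by rewrite /smono_val big_seq1 /= expr0 mul1r.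
by rewrite smono_val_mul_Xsub1 IH exprS.
Qed.

Lemma insertions_cons m a e : insertions m (a :: e) =
  (false, [:: m, a & e]) :: [seq (~~ t.1, a :: t.2) | t <- insertions m e].
Proof.
rewrite /insertions /=; congr ((_, [:: _, _ & _]) :: _).
by elim: e => //= b e ->.
Qed.

Lemma monom_cons n (x : 'I_n.+1 -> K) a e :
  monom x (a :: e) = x ord0 ^+ a * monom (x \o lift ord0) e.
Proof. by rewrite /monom big_ord_recl. Qed.

(** An insertion at place p gives the power m to [x p] and leaves the entries of [e] to the other
    variables in order; the sign, flipped at each place passed, is the Laplace sign of row p. *)
Lemma sterm_val_insertions n (x : 'I_n.+1 -> K) m e : size e = n ->
  sterm_val x (insertions m e) =
  \sum_(p < n.+1) (-1) ^+ p * x p ^+ m * monom (x \o lift p) e.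
Proof.
elim: e n x => [|a e IH] n x /= en; case: _ / en x => x.
  rewrite /sterm_val big_seq1 big_ord_recl big_ord0 addr0 monom_cons /= mulrA.
  by rewrite /monom !big_ord0.
rewrite insertions_cons /sterm_val big_cons big_map big_ord_recl /=.
rewrite monom_cons mulrA; congr (_ + _).
transitivity (- x ord0 ^+ a * sterm_val (x \o lift ord0) (insertions m e)).
  rewrite /sterm_val big_distrr; apply: eq_bigr => t _ /=.
  rewrite monom_cons signrN /= !mulNr; congr (- _); exact: mulrCA.
rewrite (IH (size e)) // big_distrr; apply: eq_bigr => p _ /=.
rewrite monom_cons /bump /= add1n exprS mulN1r !mulNr; congr (- _).
rewrite mulrCA; congr (_ * (_ * _)).
  by congr (x _ ^+ _); apply: val_inj.
by apply: eq_bigr => i _; congr (x _ ^+ _); apply: val_inj; rewrite /= /bump;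
  lia.
Qed.

Lemma size_insertions m e t : t \in insertions m e -> size t.2 = (size e).+1.
Proof.
elim: e t => [|a e IH] t; first by rewrite inE => /eqP ->.
rewrite insertions_cons inE => /orP[/eqP -> //|/mapP[u /IH ue ->]].
by rewrite /= ue.
Qed.

Lemma size_det_terms cs t : t \in det_terms cs -> size t.2 = size cs.
Proof.
elim: cs t => [|c cs IH] t /=; first by rewrite inE => /eqP ->.
case/flatten_mapP => b _ /flatten_mapP[u /IH ucs] /mapP[v].
move=> /size_insertions vu ->.
by rewrite /= vu ucs.
Qed.

Lemma sterm_val_det_terms n (x : 'I_n -> K) cs : size cs = n ->
  sterm_val x (det_terms cs) =
  \det (\matrix_(i < n, j < n) smono_val (x i) (nth [::] cs j)).
Proof.
elim: cs n x => [|c cs IH] n x /= en; case: _ / en x => x.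
  by rewrite det_mx00 /sterm_val big_seq1 /monom big_ord0 mul1r.
rewrite (expand_det_col _ ord0) /sterm_val big_flatten big_map.
transitivity (\sum_(b <- c) \sum_(t <- det_terms cs) \sum_(p < (size cs).+1)
    (-1) ^+ b.1 * (-1) ^+ t.1 *
    ((-1) ^+ p * x p ^+ b.2 * monom (x \o lift p) t.2)).
  apply: eq_bigr => b _; rewrite big_flatten big_map;
    apply: eq_big_seq => t tcs.
  rewrite -big_distrr -(sterm_val_insertions _ _ (size_det_terms tcs)) /=.
  rewrite /sterm_val big_map big_distrr; apply: eq_bigr => u _ /=.
  by rewrite !signr_addb !mulrA.
under eq_bigr do rewrite exchange_big; rewrite exchange_big /=.
apply: eq_bigr => p _; rewrite !mxE /= /smono_val big_distrl;
  apply: eq_bigr => b _ /=.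
(* The minor of row p is the matrix of the remaining columns in the variables other than [x p], so
   the induction hypothesis applies. *)
rewrite /cofactor addn0 [row' _ _](_ : _ = \matrix_(i, j)
  smono_val ((x \o lift p) i) (nth [::] cs j)); last first.
  by apply/matrixP => i j; rewrite !mxE.
rewrite -IH // /sterm_val !big_distrr; apply: eq_bigr => t _ /=; ring.
Qed.
End Values.

(** * Counting paths below a word *)

(* The list [ds] holds the distances to the boundary of the ends of the partial
   paths; the sum of [u ^ d] over [d] in [ds] is the polynomial A. *)
Definition rise (w : seq step) (ds : seq nat) : seq nat :=
  foldl (fun ds b => if b then map succn ds
                     else flatten [seq iota 0 d.+1 | d <- ds]) ds w.

(** All ways to continue a path that is [d] units below the boundary. At an E of the boundary the
    path climbs to some distance [i] at most [d] and then makes its own E; at the end it climbs what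
    is left. *)
Fixpoint completions (w : seq step) (d : nat) : seq (seq step) :=
  match w with
  | [::] => [:: nseq d stepN]
  | true :: w' => completions w' d.+1
  | false :: w' => flatten
      [seq [seq nseq (d - i) stepN ++ stepE :: p | p <- completions w' i]
         | i <- iota 0 d.+1]
  end.

(** The origin is the start of the path, [d] units below the start of [w], whence the shift of
    [v.2]. *)
Definition covered (w : seq step) (d : nat) (u : nat * nat) : bool :=
  has (fun v => (v.1 == u.1) && (u.2 <= v.2 + d)%N) (points w).

Definition stays_below (w : seq step) (d : nat) (p : seq step) : bool :=
  (endpoint p == ((endpoint w).1, (endpoint w).2 + d)%N) &&
  all (covered w d) (points p).

Lemma stays_belowE w p :
  stays_below w 0 p = (endpoint p == endpoint w) && never_above w p.
Proof.
rewrite /stays_below addn0 -surjective_pairing /never_above /strictly_above.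
rewrite -all_predC; congr (_ && _); apply: eq_all => u;
  rewrite -[RHS]/(~~ all _ _) -has_predC; apply: eq_has => v /=.
by rewrite addn0 negb_imply -leqNgt.
Qed.

Lemma points_cons b w :
  points (b :: w) = (0, 0)%N :: [seq (u.1 + ~~ b, u.2 + b)%N | u <- points w].
Proof.
have iE : iota 0 (size (b :: w)).+1 =
    0%N :: [seq (1 + i)%N | i <- iota 0 (size w).+1].
  by rewrite -(iotaDl 1 0).
rewrite /points iE map_cons -!map_comp; congr (_ :: _).
apply: (@eq_map nat) => i; rewrite /= /endpoint /= /stepE /stepN.
by case: {iE} b; rewrite ?add0n ?add1n ?addn0 ?addn1.
Qed.

Lemma points0 w : (0, 0)%N \in points w.
Proof. by case: w => // b w; rewrite points_cons inE eqxx. Qed.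

Lemma endpoint_cons b w :
  endpoint (b :: w) = ((endpoint w).1 + ~~ b, (endpoint w).2 + b)%N.
Proof.
by rewrite /endpoint [LHS]/= addnC [(_ + count _ _)%N]addnC;
  case: b.
Qed.

Lemma covered_cons b w d u : covered (b :: w) d u =
  (0%N == u.1) && (u.2 <= d)%N ||
  has (fun v => (v.1 + ~~ b == u.1)%N && (u.2 <= v.2 + b + d)%N) (points w).
Proof. by rewrite /covered points_cons /= has_map add0n. Qed.

Lemma covered_north w d u : covered (true :: w) d u = covered w d.+1 u.
Proof.
rewrite covered_cons; apply/orP/hasP => [[ud|/hasP[v vw uv]]|[v vw uv]].
- by exists (0, 0)%N; rewrite ?points0 //=; lia.
- by exists v => //; move: uv; rewrite addn0 addn1 addSnnS.
- by right; apply/hasP; exists v => //; rewrite addn0 addn1 addSnnS.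
Qed.

Lemma covered_east w d x y :
  covered (false :: w) d (x.+1, y) = covered w d (x, y).
Proof.
rewrite covered_cons -[LHS]/(has _ _); apply: eq_has => v /=.
by rewrite addn1 eqSS addn0.
Qed.

Lemma covered_eastS w d x y :
  covered (false :: w) d.+1 (x, y.+1) = covered (false :: w) d (x, y).
Proof. by rewrite /covered; apply: eq_has => v /=; rewrite addnS ltnS. Qed.

Lemma stays_below_north w d p :
  stays_below (true :: w) d p = stays_below w d.+1 p.
Proof.
rewrite /stays_below endpoint_cons addn0 -addnA; congr (_ && _).
by apply: eq_all => u; exact: covered_north.
Qed.

Lemma stays_below_nil d p : stays_below [::] d p = (p == nseq d stepN).
Proof.
rewrite /stays_below add0n; apply/andP/eqP => [[/eqP[pE pN] _]|->].
  elim: p d pE pN => [|[] p IH] d //= pE <- //.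
  by rewrite add1n /= -(IH _ pE erefl).
split; first by rewrite /endpoint !count_nseq /= mul1n mul0n.
rewrite /points all_map; apply/allP => i.
rewrite mem_iota size_nseq ltnS => /andP[_ id] /=.
rewrite take_nseq //; apply/hasP; exists (0, 0)%N; rewrite ?points0 //.
by rewrite /endpoint !count_nseq /= mul1n.
Qed.

Lemma stays_below_cons w d b p : stays_below w d (b :: p) =
  (((endpoint p).1 + ~~ b, (endpoint p).2 + b)%N
     == ((endpoint w).1, (endpoint w).2 + d)%N) &&
  covered w d (0, 0)%N &&
  all (fun u => covered w d (u.1 + ~~ b, u.2 + b)%N) (points p).
Proof.
by rewrite /stays_below endpoint_cons points_cons [all _ _]/= all_map
  andbA.
Qed.

Lemma covered0 w d : covered w d (0, 0)%N.
Proof. by apply/hasP; exists (0, 0)%N; rewrite ?points0. Qed.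

Lemma stays_below_east_nil w d : stays_below (false :: w) d [::] = false.
Proof. by rewrite /stays_below endpoint_cons addn1. Qed.

Lemma stays_below_east_east w d p :
  stays_below (false :: w) d (false :: p) = stays_below w d p.
Proof.
rewrite stays_below_cons covered0 andbT endpoint_cons !addn0 !addn1.
rewrite /stays_below !xpair_eqE eqSS; congr (_ && _).
by apply: eq_all => -[x y]; rewrite addn1 addn0 covered_east.
Qed.

(** The boundary leaves the initial vertical line at once, so at distance 0 there is no room for an
    N step. *)
Lemma stays_below_east_north0 w p :
  stays_below (false :: w) 0 (true :: p) = false.
Proof.
rewrite stays_below_cons;
  apply/negbTE/negP => /andP[_ /allP /(_ _ (points0 p))].
rewrite covered_cons -[X in X -> _]/(is_true (has _ _)) => /hasP[v _] /=.
by rewrite addn1.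
Qed.

Lemma stays_below_east_north w d p :
  stays_below (false :: w) d.+1 (true :: p) = stays_below (false :: w) d p.
Proof.
rewrite stays_below_cons covered0 andbT /stays_below.
rewrite !xpair_eqE !addn0 addn1 addnS eqSS; congr (_ && _).
by apply: eq_all => -[x y]; rewrite addn0 addn1 covered_eastS.
Qed.

Lemma completions_east w d : completions (false :: w) d = flatten
  [seq [seq nseq (d - i) stepN ++ stepE :: p | p <- completions w i]
    | i <- iota 0 d.+1].
Proof. by []. Qed.

Lemma completions_east0 w :
  completions (false :: w) 0 = map (cons stepE) (completions w 0).
Proof. by rewrite /= cats0. Qed.

(** Split by the first step of the path, which is N for all [i] up to [d] and E for [i = d + 1].
    This allows an induction on the distance. *)
Lemma completions_eastS w d : perm_eq (completions (false :: w) d.+1)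
  (map (cons stepN) (completions (false :: w) d) ++
   map (cons stepE) (completions w d.+1)).
Proof.
rewrite !completions_east -[in iota 0 d.+2]addn1 iotaD map_cat flatten_cat
  perm_cat //.
  have eq_perm (s t : seq (seq step)) : s = t -> perm_eq s t by move=> ->.
  rewrite map_flatten -map_comp; apply/eq_perm; congr flatten;
    apply/eq_in_map => i; rewrite mem_iota => /andP[_ id] /=.
  by rewrite -map_comp; apply: eq_map => q /=; rewrite subSn.
by rewrite /= cats0 add0n subnn.
Qed.

Lemma mem_map_cons (b c : step) ps p :
  (c :: p \in map (cons b) ps) = (b == c) && (p \in ps).
Proof.
have [<-|bc] := eqVneq b c; first by rewrite mem_map // => x y [].
by apply/negbTE/mapP => -[q _ [cb _]]; rewrite cb eqxx in bc.
Qed.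

Lemma nil_map_cons (b : step) ps : ([::] \in map (cons b) ps) = false.
Proof. by apply/negbTE/mapP => -[]. Qed.

Lemma mem_completions w d p : (p \in completions w d) = stays_below w d p.
Proof.
elim: w d p => [|[] w IH] d p.
- by rewrite stays_below_nil inE.
- by rewrite /= IH stays_below_north.
elim: d p => [|d IHd] p.
  rewrite completions_east0; case: p => [|[] p].
  + by rewrite nil_map_cons stays_below_east_nil.
  + by rewrite mem_map_cons stays_below_east_north0.
  + by rewrite mem_map_cons IH stays_below_east_east.
rewrite (perm_mem (completions_eastS _ _)) mem_cat; case: p => [|[] p].
+ by rewrite !nil_map_cons stays_below_east_nil.
+ by rewrite !mem_map_cons orbF IHd stays_below_east_north.
+ by rewrite !mem_map_cons IH stays_below_east_east.
Qed.

Lemma completions_uniq w d : uniq (completions w d).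
Proof.
elim: w d => [|[] w IH] d //; first exact: IH.
elim: d => [|d IHd].
  by rewrite completions_east0 map_inj_uniq // => x y [].
rewrite (perm_uniq (completions_eastS _ _)) cat_uniq !map_inj_uniq //;
  try by move=> x y [].
rewrite IHd IH andbT; apply/hasPn => p /mapP[q _ ->].
by rewrite mem_map_cons.
Qed.

Lemma rise_north w ds : rise (true :: w) ds = rise w (map succn ds).
Proof. by []. Qed.

Lemma rise_east w ds :
  rise (false :: w) ds = rise w (flatten [seq iota 0 d.+1 | d <- ds]).
Proof. by []. Qed.

(** [rise] branches at each letter exactly as [completions] does, and at the end each distance has a
    single completion. *)
Lemma size_rise w ds : size (rise w ds) = \sum_(d <- ds) size (completions w d).
Proof.
elim: w ds => [|[] w IH] ds.
- by rewrite -sum1_size; apply: eq_bigr.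
- by rewrite rise_north IH big_map.
- rewrite rise_east IH big_flatten big_map; apply: eq_bigr => d _.
  rewrite completions_east size_flatten sumnE !big_map.
  by apply: eq_bigr => i _; rewrite size_map.
Qed.

Lemma endpoint_cat w w' : endpoint (w ++ w') =
  ((endpoint w).1 + (endpoint w').1, (endpoint w).2 + (endpoint w').2)%N.
Proof. by rewrite /endpoint !count_cat. Qed.

Lemma endpoint_period s : endpoint (period s) = (lsum s, ksum s).
Proof.
rewrite /lsum /ksum; elim: s => [|x s IH]; first by rewrite !big_nil.
rewrite !big_cons /period /= !endpoint_cat -/(period s) IH.
by rewrite /endpoint !count_nseq /= !mul1n !mul0n addn0 add0n.
Qed.

Lemma endpoint_boundary s n :
  endpoint (boundary s n) = (lsum s * n, ksum s * n)%N.
Proof.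
elim: n => [|n IH]; first by rewrite !muln0.
by rewrite /boundary /= endpoint_cat endpoint_period -/(boundary s n) IH !mulnS.
Qed.

Lemma size_endpoint w : size w = ((endpoint w).1 + (endpoint w).2)%N.
Proof.
rewrite /endpoint -(count_predC (pred1 stepE) w); congr (_ + _)%N.
by apply: eq_count => -[].
Qed.

Lemma npaths_rise s n : npaths s n = size (rise (boundary s n) [:: 0%N]).
Proof.
rewrite size_rise big_seq1 /npaths cardE -(size_map val); apply: perm_size.
apply: uniq_perm; rewrite ?completions_uniq ?(map_inj_uniq val_inj) ?enum_uniq
  //.
move=> p; rewrite mem_completions stays_belowE endpoint_boundary.
apply/mapP/idP => [[t]|pP]; first by rewrite mem_enum inE => tP ->.
have sp : size p == (lsum s * n + ksum s * n)%N.
  by case/andP: pP => /eqP pE _; rewrite size_endpoint pE.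
by exists (Tuple sp); rewrite // mem_enum inE.
Qed.

(** * The functional equation of one period *)

Fixpoint word_exps (w : seq step) : seq nat :=
  match w with
  | [::] => [::]
  | true :: w' => word_exps w'
  | false :: w' => size w' :: word_exps w'
  end.

(** The numbers B_(n,j): the size of the multiset of distances, that is, its polynomial at u = 1,
    just before each E. *)
Fixpoint rise_sizes (w : seq step) (ds : seq nat) : seq nat :=
  match w with
  | [::] => [::]
  | true :: w' => rise_sizes w' (map succn ds)
  | false :: w' =>
      size ds :: rise_sizes w' (flatten [seq iota 0 d.+1 | d <- ds])
  end.

Lemma size_word_exps w : size (word_exps w) = (endpoint w).1.
Proof.
by elim: w => [|[] w IH] //;
  rewrite endpoint_cons ?addn0 ?addn1 /= IH.
Qed.

(** N steps shift the distances without changing their number. This is what gives B_(n,0) = q_n. *)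
Lemma rise_sizes0 w ds : (0 < (endpoint w).1)%N ->
  nth 0%N (rise_sizes w ds) 0 = size ds.
Proof.
by elim: w ds => [|[] w IH] ds //; rewrite endpoint_cons addn0 => /IH ->;
  rewrite size_map.
Qed.

Lemma east_exps_period s : east_exps s = word_exps (period s).
Proof.
rewrite /east_exps; suff -> : foldr east_exps_from (0%N, [::]) s =
  (size (period s), word_exps (period s)) by [].
elim: s => //= -[a b] s ->; rewrite /east_exps_from /period /=.
rewrite -catA; set w := flatten _.
have -> : iter b (fun st : nat * seq nat => (st.1.+1, st.1 :: st.2))
    (size w, word_exps w) =
    (size (nseq b stepE ++ w), word_exps (nseq b stepE ++ w)).
  by elim: b => //= b ->.
by elim: a => //= a ->.
Qed.

Section RiseValue.
Variable K : comNzRingType.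
Implicit Type x : K.

Definition multiset_val x (ds : seq nat) : K := \sum_(d <- ds) x ^+ d.

Lemma multiset_val_north x ds :
  multiset_val x (map succn ds) = x * multiset_val x ds.
Proof.
rewrite /multiset_val big_map big_distrr; apply: eq_bigr => d _.
exact: exprS.
Qed.

(** A geometric sum for each distance: (x - 1)(1 + ... + x^d) = x^(d+1) - 1. *)
Lemma multiset_val_east x ds :
  (x - 1) * multiset_val x (flatten [seq iota 0 d.+1 | d <- ds]) =
  x * multiset_val x ds - (size ds)%:R.
Proof.
rewrite /multiset_val big_flatten big_map -sum1_size natr_sum !big_distrr
  -sumrB.
apply: eq_bigr => d _.
rewrite -[X in iota _ X]subn0 -/(index_iota 0 d.+1) big_mkord.
by rewrite -[RHS]/(x * _ - 1) -exprS subrX1.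
Qed.

(** The correction made at the j-th E gets a factor x from each later letter, hence x^(e_j), and a
    factor x - 1 from each of the j earlier E steps. Multiplying instead of dividing keeps it valid
    in any commutative ring. *)
Lemma multiset_val_rise x w ds :
  (x - 1) ^+ (endpoint w).1 * multiset_val x (rise w ds) =
  x ^+ size w * multiset_val x ds -
  \sum_(j < (endpoint w).1)
    (x - 1) ^+ j * x ^+ nth 0%N (word_exps w) j *
    (nth 0%N (rise_sizes w ds) j)%:R.
Proof.
elim: w ds => [|[] w IH] ds; first by rewrite big_ord0 subr0.
  by rewrite rise_north endpoint_cons addn0 IH multiset_val_north exprSr mulrA.
rewrite rise_east endpoint_cons addn1 exprS -mulrA IH mulrBr mulrCA.
rewrite multiset_val_east mulrBr mulrA -exprSr big_ord_recl /= expr0 mul1r.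
rewrite opprD addrA; congr (_ - _ - _).
by rewrite big_distrr; apply: eq_bigr => j _; rewrite /= exprS !mulrA.
Qed.
End RiseValue.

(** * Nonvanishing of the denominator *)

Section Unisolvence.
Variables (O : comNzRingType) (K F : fieldType).
Variables (f : {rmorphism O -> K}) (rho : {rmorphism O -> F}) (r : F).
Hypothesis unit_residue : forall a, rho a != 0 -> f a != 0.

(** Elimination at the node [x 0]: each [g j.+1], cleared at that node with [g 0], is divisible by X
    - x_0. The quotients have order exactly j at r modulo the residue map, so they satisfy the
    hypotheses at the remaining nodes. *)
Lemma unisolvence n (g : nat -> {poly O}) (x : nat -> O) :
  (forall i, (i < n)%N -> rho (x i) = r) ->
  (forall i j, (i < n)%N -> (j < n)%N -> f (x i) = f (x j) -> i = j) ->
  (forall j, (j < n)%N -> exists2 q : {poly F},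
     map_poly rho (g j) = ('X - r%:P) ^+ j * q & q.[r] != 0) ->
  forall c : nat -> K,
  (forall i, (i < n)%N -> \sum_(j < n) c j * f (g j).[x i] = 0) ->
  forall j, (j < n)%N -> c j = 0.
Proof.
elim: n g x => // n IH g x rx xI gq c c0.
have rhoE p a : rho p.[a] = (map_poly rho p).[rho a] by rewrite horner_map.
have g00 : rho (g 0%N).[x 0%N] != 0.
  by have [q gE q0] := gq 0%N isT; rewrite rhoE rx // gE expr0 mul1r.
have /choice[h hE] j : exists h, (g 0%N).[x 0%N] *: g j.+1 -
    (g j.+1).[x 0%N] *: g 0%N = h * ('X - (x 0%N)%:P).
  by apply/factor_theorem; rewrite rootE !hornerE mulrC subrr.
have cS j : (j < n)%N -> c j.+1 = 0.
  apply: (IH h (fun i => x i.+1) _ _ _ (fun j => c j.+1)).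
  - by move=> i i_n; exact: rx.
  - by move=> i k i_n k_n /xI; move=> /(_ i_n k_n) [].
  - move=> k k_n; have [q gE q0] := gq k.+1 k_n.
    (* [g k.+1] has residue zero at [x 0], so the second term of [hE] disappears and one factor X -
       r cancels. *)
    exists (rho (g 0%N).[x 0%N] *: q); last by rewrite hornerZ mulf_neq0.
    have X0 : 'X - r%:P != 0 :> {poly F} by rewrite polyXsubC_eq0.
    apply: (mulIf X0).
    have := congr1 (map_poly rho) (hE k).
    rewrite rmorphM rmorphB /= !map_polyZ /= map_polyXsubC rx // => <-.
    rewrite [rho (g k.+1).[_]]rhoE gE rx // !hornerE subrr expr0n mul0r scale0r
      subr0.
    by rewrite -!mul_polyC exprSr; ring.
  - move=> i i_n.
    have xx : f (x i.+1) - f (x 0%N) != 0.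
      by rewrite subr_eq0; apply/eqP => /xI; move=> /(_ i_n isT).
    apply: (mulfI xx); rewrite mulr0.
    (* The relations at [x i.+1] and [x 0] are combined so that the term of [c 0] cancels; by [hE]
       each other term acquires the factor f(x_(i+1)) - f(x_0). *)
    transitivity (f (g 0%N).[x 0%N] * (\sum_(j < n.+1) c j * f (g j).[x i.+1]) -
      f (g 0%N).[x i.+1] * (\sum_(j < n.+1) c j * f (g j).[x 0%N])); last first.
      by rewrite !c0 // !mulr0 subrr.
    rewrite !big_distrr /= -sumrB big_ord_recl /=.
    rewrite [X in _ = X + _](_ : _ = 0); last by ring.
    rewrite add0r; apply: eq_bigr => k _; rewrite /bump /= add1n.
    have := congr1 (fun p => f p.[x i.+1]) (hE k).
    rewrite !hornerE !(rmorphM, rmorphB) /= => hk.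
    transitivity (c k.+1 * (f (h k).[x i.+1] * (f (x i.+1) - f (x 0%N))));
      first by ring.
    by rewrite -hk; ring.
case=> [_|j]; last exact: cS.
have := c0 0%N isT; rewrite big_ord_recl big1 => [|j _];
  last by rewrite cS // mul0r.
by move=> /eqP; rewrite addr0 mulf_eq0 (negPf (unit_residue g00)) orbF => /eqP.
Qed.

Lemma det_unisolvence n (g : nat -> {poly O}) (x : 'I_n -> O) :
  (forall i, rho (x i) = r) -> injective (f \o x) ->
  (forall j, (j < n)%N -> exists2 q : {poly F},
     map_poly rho (g j) = ('X - r%:P) ^+ j * q & q.[r] != 0) ->
  \det (\matrix_(i < n, j < n) f (g j).[x i]) != 0.
Proof.
case: n x => [|n] x rx xI gq; first by rewrite det_mx00 oner_eq0.
rewrite -det_tr; apply/det0P => -[v /eqP v0 vA]; apply: v0.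
apply/rowP => j; rewrite mxE -[j]inord_val.
apply: (@unisolvence n.+1 g (fun i => x (inord i)) _ _ gq
  (fun j => v 0 (inord j))) => //.
- move=> i k i_n k_n /xI /(congr1 val); rewrite /= !inordK //.
- move=> i i_n; have := congr1 (fun w : 'rV_n.+1 => w 0 (inord i)) vA.
  rewrite !mxE => {2}<-; apply: eq_bigr => k _.
  by rewrite !mxE inord_val.
Qed.
End Unisolvence.

(** * Fractional power series *)

Section FractionalPowerSeries.
Variable F : fieldType.
Implicit Types (f g : puiseux F) (a b : rat).

Definition order_ge a f : Prop := forall b, b < a -> f b = 0.

Lemma order_geM a b f g :
  order_ge a f -> order_ge b g -> order_ge (a + b) (f * g).
Proof.
move=> fa gb c cab; rewrite [LHS]/= /pmul_coef fsbig1 // => d _.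
have [da|ad] := ltP d a; first by rewrite fa // mul0r.
by rewrite [g _]gb ?mulr0 // ltrBlDr (lt_le_trans cab) // addrC lerD2l.
Qed.

Lemma coef0M f g : order_ge 0 f -> order_ge 0 g -> (f * g) 0 = f 0 * g 0.
Proof.
move=> f0 g0; rewrite [LHS]/= /pmul_coef (fsbigE [:: 0]) //= => [|d _].
  by rewrite big_cons big_nil in_setT subrr addr0.
rewrite inE sub0r; case: (ltgtP d 0) => // [dn|dp] _.
  by rewrite f0 // mul0r.
by rewrite g0 ?mulr0 // oppr_lt0.
Qed.

Definition fps_pred : {pred puiseux F} :=
  fun f => `[< fractional_power_series f >].

Lemma fpsP f : reflect (fractional_power_series f) (f \in fps_pred).
Proof. exact: asboolP. Qed.

Fact fps_subring : subring_closed fps_pred.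
Proof.
split=> [|f g /fpsP f0 /fpsP g0|f g /fpsP f0 /fpsP g0]; apply/fpsP.
- by move=> a a0 /=; rewrite lt_eqF.
- by move=> a a0; rewrite [LHS]/= f0 // g0 // subr0.
- by have := order_geM f0 g0; rewrite addr0.
Qed.
HB.instance Definition _ := GRing.isSubringClosed.Build _ fps_pred fps_subring.

(** This ring is the [O] of [unisolvence]: its inclusion into the Puiseux series is [f], and the
    constant coefficient is [rho]. *)
Record fps := Fps { fps_val :> puiseux F; _ : fps_val \in fps_pred }.
HB.instance Definition _ := [isSub for fps_val].
HB.instance Definition _ := [Choice of fps by <:].
HB.instance Definition _ := [SubChoice_isSubComNzRing of fps by <:].

Lemma fpsE (x : fps) : fractional_power_series (val x).
Proof. exact/fpsP/valP. Qed.

Definition residue (x : fps) : F := val x 0.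

Fact residue_additive : zmod_morphism residue.
Proof. by []. Qed.
HB.instance Definition _ := GRing.isZmodMorphism.Build fps F residue
  residue_additive.
Fact residue_multiplicative : monoid_morphism residue.
Proof. by split=> [|x y]; rewrite /residue ?coef0M //; exact: fpsE. Qed.
HB.instance Definition _ := GRing.isMonoidMorphism.Build fps F residue
  residue_multiplicative.

End FractionalPowerSeries.

(** * The kernel equation summed over all periods *)

Section Kernel.
Variable F : fieldType.
Implicit Types (f g : puiseux F) (a b : rat).

Lemma order_ge_fpsM a f g :
  f \in @fps_pred F -> order_ge a g -> order_ge a (f * g).
Proof. by move=> /fpsP f0 ga; have := order_geM f0 ga; rewrite add0r. Qed.

Lemma order_geD a f g : order_ge a f -> order_ge a g -> order_ge a (f + g).
Proof. by move=> fa ga b ba; rewrite [LHS]/= fa // ga // addr0. Qed.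

Lemma order_geN a f : order_ge a f -> order_ge a (- f).
Proof. by move=> fa b ba; rewrite [LHS]/= fa // oppr0. Qed.

Lemma order_ge_sum a (I : finType) (f : I -> puiseux F) :
  (forall i, order_ge a (f i)) -> order_ge a (\sum_i f i).
Proof.
by move=> fa; elim/big_ind: _ => // g h; exact: order_geD.
Qed.

(** Stands in for convergence: an identity of infinite sums is truncated at N, and the remainder has
    order at least N for every N. *)
Lemma order_ge_eq0 f : (forall n : nat, order_ge n%:R f) -> f = 0.
Proof.
move=> f0; apply: puiseuxP => a.
exact: (f0 (Num.truncn a).+1 _ (truncnS_gt a)).
Qed.

Lemma pz_fps : pz F \in @fps_pred F.
Proof. by apply/fpsP => a a0 /=; rewrite lt_eqF // (lt_trans a0). Qed.

Lemma pz_coef_mul f a : (pz F * f) a = f (a - 1).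
Proof.
rewrite [LHS]/= /pmul_coef (fsbigE [:: 1]) //= => [|d _].
  by rewrite big_cons big_nil in_setT eqxx mul1r addr0.
by rewrite inE => /negPf ->; rewrite mul0r.
Qed.

Lemma pz_exp_coef n a : (pz F ^+ n) a = (a == n%:R)%:R.
Proof.
elim: n a => [|n IH] a //; rewrite exprS pz_coef_mul IH; congr (_%:R).
by rewrite subr_eq -natr1.
Qed.

Lemma order_ge_pzX n : order_ge n%:R (pz F ^+ n).
Proof. by move=> b bn; rewrite pz_exp_coef lt_eqF. Qed.

Lemma natr_coef_mul m f a : (m%:R * f) a = m%:R * f a.
Proof.
rewrite !mulr_natl; elim: m => [|m IH]; first by rewrite !mulr0n.
by rewrite !mulrS -IH.
Qed.

Lemma sum_coef (I : finType) (f : I -> puiseux F) a :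
  (\sum_i f i) a = \sum_i f i a.
Proof. exact: (big_morph (fun g : puiseux F => g a)). Qed.

Lemma order_ge_pseries_sub (u : nat -> nat) n : order_ge n%:R
  (pseries (fun i => (u i)%:R) - \sum_(i < n) (u i)%:R * pz F ^+ i).
Proof.
move=> a an; rewrite [LHS](_ : _ = pseries (fun i => (u i)%:R) a -
  (\sum_(i < n) (u i)%:R * pz F ^+ i) a) // sum_coef [pcoef _ _]/=.
under eq_bigr do rewrite natr_coef_mul pz_exp_coef.
case: ifP => [/natrP[m aE]|aN].
  move: an; rewrite aE natrK ltr_nat => mn; rewrite (bigD1 (Ordinal mn)) //=.
  rewrite eqxx mulr1 big1 ?addr0 ?subrr // => i im.
  by rewrite eqr_nat eq_sym; move: im; rewrite -val_eqE => /negPf ->;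
    exact: mulr0.
rewrite big1 ?subrr // => i _; case: eqP => [aE|_]; last exact: mulr0.
by rewrite aE natr_nat in aN.
Qed.

Definition period_rise (s : seq (nat * nat)) n := rise (boundary s n) [:: 0%N].

Lemma period_riseS s n : period_rise s n.+1 = rise (period s) (period_rise s n).
Proof.
by rewrite /period_rise /boundary -addn1 nseqD flatten_cat /= cats0 /rise
  foldl_cat.
Qed.

Lemma kernel_relation s (x : puiseux F) :
  x \in @fps_pred F -> (x - 1) ^+ lsum s = pz F * x ^+ (ksum s + lsum s) ->
  \sum_(j < lsum s) (x - 1) ^+ j * x ^+ nth 0%N (east_exps s) j *
    (pz F * pseries (fun n =>
       (nth 0%N (rise_sizes (period s) (period_rise s n)) j)%:R))
  = (x - 1) ^+ lsum s.
Proof.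
set l := lsum s; move=> xF xK.
set M := fun j => (x - 1) ^+ j * x ^+ nth 0%N (east_exps s) j.
set B := fun j n => nth 0%N (rise_sizes (period s) (period_rise s n)) j.
have sizeW : size (period s) = (ksum s + l)%N.
  by rewrite size_endpoint endpoint_period addnC.
(* By the kernel equation [xK] the n-th term is (x - 1)^l (z^n A_n - z^(n+1) A_(n+1)), so the sum
   telescopes from A_0 = 1. *)
have partial N : \sum_(n < N) pz F ^+ n.+1 * (\sum_(j < l) M j * (B j n)%:R) =
    (x - 1) ^+ l * (1 - pz F ^+ N * multiset_val x (period_rise s N)).
  elim: N => [|N IH].
    by rewrite big_ord0 /multiset_val big_seq1 expr0 mulr1 subrr mulr0.
  rewrite big_ord_recr /= IH.
  have := multiset_val_rise x (period s) (period_rise s N).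
  rewrite endpoint_period sizeW -period_riseS /= => rE.
  have -> : \sum_(j < l) M j * (B j N)%:R =
      x ^+ (ksum s + l) * multiset_val x (period_rise s N)
      - (x - 1) ^+ l * multiset_val x (period_rise s N.+1).
    by rewrite rE opprB addrCA subrr addr0 /M east_exps_period.
  rewrite exprS; move: xK; move: ((x - 1) ^+ l) (x ^+ (ksum s + l)) => a y ->.
  by ring.
have valF N : multiset_val x (period_rise s N) \in @fps_pred F.
  by apply: rpred_sum => d _; exact: rpredX.
have MF j : M j \in @fps_pred F by rewrite rpredM ?rpredX // rpredB ?rpred1.
apply/subr0_eq/order_ge_eq0 => N.
(* The difference of the two sides splits into the tails of the series B_j and the last term of the
   telescoping sum, which carries z^N. *)
rewrite [X in order_ge _ X](_ : _ =
  \sum_(j < l) M j * (pz F * (pseries (fun n => (B j n)%:R) -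
                       \sum_(n < N) (B j n)%:R * pz F ^+ n))
  - (x - 1) ^+ l * multiset_val x (period_rise s N) * pz F ^+ N).
  apply: order_geD.
    apply: order_ge_sum => j; apply: order_ge_fpsM; first exact: MF.
    by apply: order_ge_fpsM pz_fps _; exact: order_ge_pseries_sub.
  apply/order_geN/order_ge_fpsM; last exact: order_ge_pzX.
  by rewrite rpredM // rpredX // rpredB ?rpred1.
have -> : \sum_(j < l) M j * (pz F * (pseries (fun n => (B j n)%:R) -
                       \sum_(n < N) (B j n)%:R * pz F ^+ n)) =
   \sum_(j < l) M j * (pz F * pseries (fun n => (B j n)%:R)) -
   \sum_(n < N) pz F ^+ n.+1 * (\sum_(j < l) M j * (B j n)%:R).
  under [X in _ = _ - X]eq_bigr do rewrite big_distrr.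
  rewrite exchange_big -sumrB; apply: eq_bigr => j _ /=.
  rewrite !mulrBr; congr (_ - _); rewrite !big_distrr; apply: eq_bigr => n _ /=.
  by rewrite exprS; ring.
by rewrite partial; ring.
Qed.
End Kernel.

(** * Determinants as polynomials, and the theorem *)

(** The cofactors along column [j0] are the same for both matrices, and the adjugate of A times A t
    is det A times t; no division is involved. *)
Lemma cramer_col (K : comNzRingType) n (A A' : 'M[K]_n) (j0 : 'I_n)
    (t : 'I_n -> K) :
  (forall i, A' i j0 = \sum_j A i j * t j) ->
  (forall i j, j != j0 -> A' i j = A i j) ->
  \det A' = t j0 * \det A.
Proof.
move=> A'0 A'E; rewrite (expand_det_col _ j0).
have cofE i : cofactor A' i j0 = \adj A j0 i.
  rewrite mxE /cofactor; congr (_ * \det _); apply/matrixP => k j.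
  by rewrite !mxE A'E // eq_sym neq_lift.
transitivity (\sum_j (\adj A *m A) j0 j * t j).
  under [RHS]eq_bigr do rewrite mxE big_distrl.
  rewrite exchange_big; apply: eq_bigr => i _ /=.
  rewrite A'0 cofE big_distrl; apply: eq_bigr => j _ /=; ring.
rewrite mul_adj_mx (bigD1 j0) //= big1 ?addr0 => [|j jj0].
  by rewrite mxE eqxx mulr1n mulrC.
by rewrite mxE eq_sym (negPf jj0) mulr0n mul0r.
Qed.

Section DetPolynomial.
Variables (n : nat) (cs : seq (seq smono)).

Definition det_poly : {mpoly int[n]} :=
  \det (\matrix_(i < n, j < n) smono_val 'X_i (nth [::] cs j)).

Lemma poly_of_det_terms :
  size cs = n -> poly_of n (to_terms (det_terms cs)) = det_poly.
Proof.
move=> csn; rewrite /det_poly -sterm_val_det_terms // /poly_of big_map.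
apply: eq_bigr => t _ /=; rewrite mpolyXE_id -mul_mpolyC /monom.
congr (_ * _); last by apply: eq_bigr => i _; rewrite mnmE.
by case: t.1; rewrite ?NegzE ?mpolyCN mpolyC1 ?expr1 ?expr0.
Qed.

Lemma rmorph_smono_val (K L : comNzRingType) (f : {rmorphism K -> L}) x c :
  f (smono_val x c) = smono_val (f x) c.
Proof.
rewrite /smono_val rmorph_sum; apply: eq_bigr => t _.
by rewrite rmorphM rmorph_sign rmorphXn.
Qed.

Lemma rmorph_det_poly (K : comNzRingType)
    (f : {rmorphism {mpoly int[n]} -> K}) :
  f det_poly = \det (\matrix_(i < n, j < n) smono_val (f 'X_i) (nth [::] cs j)).
Proof.
rewrite -det_map_mx; congr (\det _); apply/matrixP => i j.
by rewrite !mxE rmorph_smono_val.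
Qed.

Lemma mmap_det_poly (K : comNzRingType) (w : 'I_n -> K) :
  mmap intr w det_poly =
  \det (\matrix_(i < n, j < n) smono_val (w i) (nth [::] cs j)).
Proof.
rewrite (rmorph_det_poly (mmap intr w)); congr (\det _); apply/matrixP => i j.
by rewrite !mxE /= mmapX mmap1U.
Qed.

(** Row i involves only the variable of index i, so permuting the variables permutes the rows. *)
Lemma msym_det_poly (s : 'S_n) : msym s det_poly = (-1) ^+ s * det_poly.
Proof.
rewrite (rmorph_det_poly (msym s)) -det_perm -det_mulmx -row_permE.
congr (\det _); apply/matrixP => i j.
by rewrite !mxE /= /msym mmapX mmap1U.
Qed.
End DetPolynomial.

Lemma alternating_symmetric_ratfun n (A B : {mpoly int[n]}) :
  (forall s, msym s A = (-1) ^+ s * A) ->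
  (forall s, msym s B = (-1) ^+ s * B) ->
  B != 0 -> symmetric_ratfun (A, B).
Proof.
by move=> altA altB B0; split=> // s; rewrite /= altA altB -mulrA mulrCA.
Qed.

Lemma det_columns_neq0 (O : comNzRingType) (K F : fieldType)
    (f : {rmorphism O -> K}) (rho : {rmorphism O -> F}) n es (x : 'I_n -> O) :
  (forall a, rho a != 0 -> f a != 0) -> size es = n ->
  (forall i, rho (x i) = 1) -> injective (f \o x) ->
  \det (\matrix_(i < n, j < n)
    smono_val (f (x i)) (nth [::] (columns es) j)) != 0.
Proof.
move=> unit_res esn rx xI.
have := @det_unisolvence _ _ _ f rho 1 unit_res n
  (fun j => ('X - 1%:P) ^+ j * 'X^(nth 0%N es j)) x rx xI.
rewrite (_ : \matrix_(_, _) _ = \matrix_(i < n, j < n)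
   smono_val (f (x i)) (nth [::] (columns es) j)); last first.
  apply/matrixP => i j; rewrite !mxE smono_val_columns ?esn //.
  by rewrite !hornerE rmorphM !rmorphXn rmorphB rmorph1.
(* The residue of the polynomial is (X - 1)^j X^(e_j), and X^(e_j) takes the value 1 at 1. *)
apply=> j _; exists ('X^(nth 0%N es j));
  last by rewrite hornerXn expr1n oner_eq0.
by rewrite rmorphM !rmorphXn /= map_polyXsubC map_polyX rmorph1.
Qed.

Lemma det_poly_columns_neq0 n es : size es = n -> det_poly n (columns es) != 0.
Proof.
(* The polynomial is nonzero at 1, 3, 5, ..., which are all 1 modulo 2. *)
move=> esn; pose x (i : 'I_n) : int := 1 + 2 * i%:Z.
have xI : injective (intr \o x : 'I_n -> rat).
  by move=> i j /intr_inj /addrI /(mulfI _) ij; apply: val_inj; case: (ij isT).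
have x1 i : (x i)%:~R = 1 :> 'F_2.
  rewrite /x intrD intrM [X in _ + X * _](_ : _ = 0) ?mul0r ?addr0 //.
  exact: val_inj.
have unit_res (a : int) : a%:~R != 0 :> 'F_2 -> a%:~R != 0 :> rat.
  by apply: contra_neq => /eqP; rewrite intr_eq0 => /eqP ->.
have := @det_columns_neq0 int rat 'F_2 intr intr n es x unit_res esn x1 xI.
by apply: contra_neq => d0; rewrite -(mmap_det_poly (columns es)) d0 mmap0.
Qed.

Theorem theorem2 :
  exists p : prog,
  forall s : seq (nat * nat),
  s != [::] -> all (fun x => (0 < x.1)%N && (0 < x.2)%N) s ->
  exists c : terms * terms,
  runs p (enc_input s) (enc_pair enc_terms enc_terms c) /\
  let k := ksum s in
  let l := lsum s in
  let R := (poly_of l c.1, poly_of l c.2) in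
  symmetric_ratfun R /\
  forall (Re : realType) (w : 'I_l -> puiseux Re[i]),
  fps_solutions k w ->
  ratfun_defined R w /\
  pseries (fun n => (npaths s n)%:R) = (pz _)^-1 * ratfun_eval R w.
Proof.
have [p pP] := computable_ratfun_of; exists p => s s0 s_pos.
exists (ratfun_of s); split; first exact: pP.
move=> k l R; set es := east_exps s.
have esl : size es = l.
  by rewrite /es east_exps_period size_word_exps endpoint_period.
have l0 : (0 < l)%N.
  rewrite /l /lsum; case: (s) s0 s_pos => // x s' _ /= /andP[/andP[_ x0] _].
  by rewrite big_cons addn_gt0 x0.
set den := columns es; set num := rhs_column es :: behead den.
have denl : size den = l by rewrite size_columns.
have numl : size num = l by rewrite /= size_behead denl prednK.
have R1 : R.1 = det_poly l num by apply: poly_of_det_terms.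
have R2 : R.2 = det_poly l den by apply: poly_of_det_terms.
(* Keeps unification from computing the terms of the two components of R. *)
clearbody R; split.
  rewrite [R]surjective_pairing R1 R2; apply: alternating_symmetric_ratfun.
  - exact: msym_det_poly.
  - exact: msym_det_poly.
  - exact: det_poly_columns_neq0.
move=> Re w [w_inj w_sol].
have [wF wE] : (forall i, w i \in @fps_pred _) /\
    (forall i, (w i - 1) ^+ l = pz _ * w i ^+ (k + l)).
  split=> i; have [_ /(_ (ex_intro _ i erefl))[iF /subr0_eq iE]] := w_sol (w i).
    exact/fpsP.
  exact: iE.
have val1 : mmap intr w R.1 =
    \det (\matrix_(i < l, j < l) smono_val (w i) (nth [::] num j)).
  by rewrite R1 mmap_det_poly.
have val2 : mmap intr w R.2 =
    \det (\matrix_(i < l, j < l) smono_val (w i) (nth [::] den j)).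
  by rewrite R2 mmap_det_poly.
have D0 : mmap intr w R.2 != 0.
  rewrite val2.
  pose x i : fps _ := Fps (wF i).
  apply: (@det_columns_neq0 _ _ _ (val : fps _ -> puiseux _) (@residue _) _ _
    x) => //.
    by move=> a; apply: contraNneq => a0; rewrite /= /residue a0.
  (* Since z has residue 0, the kernel equation reduces to (w_i(0) - 1)^l = 0, and l is positive. *)
  move=> i; apply/eqP; rewrite -subr_eq0.
  have xE : (x i - 1) ^+ l = Fps (pz_fps _) * x i ^+ (k + l).
    by apply: val_inj; rewrite rmorphXn rmorphM rmorphXn rmorphB rmorph1 /= wE.
  have := congr1 (@residue _) xE; rewrite rmorphM !rmorphXn rmorphB rmorph1 /=.
  by rewrite [residue (Fps _)]/= mul0r => /eqP; rewrite expf_eq0 l0.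
split=> //.
rewrite /ratfun_eval.
have -> : mmap intr w R.1 =
    pz _ * pseries (fun n => (npaths s n)%:R) * mmap intr w R.2.
  rewrite val1 val2.
  (* The unknowns z B_j(z) of the linear system, whose row i is the kernel relation at [w i]. *)
  pose t (j : 'I_l) := pz Re[i] * pseries (fun n =>
    (nth 0%N (rise_sizes (period s) (period_rise s n)) j)%:R).
  have -> : pz _ * pseries (fun n => (npaths s n)%:R) = t (Ordinal l0).
    rewrite /t; congr (_ * pseries _); apply/funext => n.
    by rewrite npaths_rise rise_sizes0 // endpoint_period.
  apply: cramer_col => [i|i j j0]; rewrite mxE.
    rewrite smono_val_rhs esl -(kernel_relation (wF i) (wE i)).
    apply: eq_bigr => j _; rewrite mxE smono_val_columns ?esl //.
  by rewrite mxE /num /den; case: j j0 => -[|j] jl //= _; rewrite nth_behead.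
rewrite mulfK // mulKf //;
  apply/eqP => /(congr1 (fun g : puiseux _ => g 1)) /eqP.
by rewrite /= oner_eq0.
Qed.
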